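(* Let $k$ be the finite field with $q$ elements and $l\ge1$. The set $$\mathcal M^l=\mathcal A^l\cup\{\alpha_1\cdots\alpha_l\in\mathcal C^l : \alpha_1\cdots\alpha_{l-1}\in\mathcal A^{l-1}\text{ and }\alpha_2\cdots\alpha_l\in\mathcal A^{l-1}\}$$ is a mock parity check set of length $l$ in $k^l$ (with alphabet $E=k$).
   Context: For a field $k$, let $F_k$ be the free monoid of finite words with letters in $k$, $F_k^l=k^l$ the words of length $l$. For $\alpha\in k$ put $M_\alpha=\begin{pmatrix}0&-1\\1&\alpha\end{pmatrix}$ and $\pi(\alpha_1\cdots\alpha_l)=M_{\alpha_1}\cdots M_{\alpha_l}\in\mathrm{SL}_2(k)$ (identity for the empty word). Let $\mathcal A$ be the set of words $w$ with $\pi(w)$ having lower-right entry $0$ (equivalently $\pi(w)=\begin{pmatrix}a&-b\\ b^{-1}&0\end{pmatrix}$, $a\in k$, $b\in k^*$), $\mathcal C=F_k\setminus\mathcal A$, $\mathcal A^l=\mathcal A\cap F_k^l$, $\mathcal C^l=\mathcal C\cap F_k^l$. For a finite set $E$ with $N\ge2$ elements and words $w=\alpha_0\cdots\alpha_{d-1}$, $w'=\alpha_1\cdots\alpha_d$ in $E^d$, $w'$ is an immediate successor of $w$ and $w$ an immediate predecessor of $w'$. A mock parity check set of length $d$ is a subset $\mathcal M\subset E^d$ such that each element of $\mathcal M$ has a unique immediate successor and a unique immediate predecessor in $\mathcal M$, and $\#\mathcal M=N^{d-1}$. *)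

(* Defs.v *)
From mathcomp Require Import all_boot all_order all_algebra.

Set Implicit Arguments.
Unset Strict Implicit.
Unset Printing Implicit Defensive.

Import GRing.Theory.
Local Open Scope ring_scope.

Section Words.
Variable k : fieldType.

Definition Mgen (a : k) : 'M[k]_2 :=
  \matrix_(i, j) if i == 0 then (if j == 0 then 0 else -1)
                 else (if j == 0 then 1 else a).

Definition word_mx (w : seq k) : 'M[k]_2 := \prod_(a <- w) Mgen a.

(* Rows and columns are numbered from 0, so this is the lower-right entry. *)
Definition wordA : {pred seq k} := [pred w | word_mx w 1 1 == 0].

Definition wordC : {pred seq k} := [predC wordA].

End Words.

Arguments wordA {k}.
Arguments wordC {k}.

Section FiniteWords.
Variables (k : finFieldType) (l : nat).

Definition words_A : {set l.-tuple k} := [set w | tval w \in wordA].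

Definition words_C : {set l.-tuple k} := [set w | tval w \in wordC].

(* The prefix and the suffix are taken as sequences; for 0 < l they have
   length l - 1. *)
Definition words_M : {set l.-tuple k} :=
  words_A :|: [set w in words_C | (take l.-1 w \in wordA) && (behead w \in wordA)].

End FiniteWords.

Section MockParityCheck.
Variables (E : finType) (d : nat).

Definition immediate_successor (w w' : d.-tuple E) : Prop :=
  exists a : d.+1.-tuple E, tval w = take d a /\ tval w' = behead a.

(* Meaningful for 0 < d: the exponent d.-1 is truncated at d = 0. *)
Definition mock_parity_check_set (M : {set d.-tuple E}) : Prop :=
  [/\ (1 < #|E|)%N,
      forall w, w \in M -> exists! w', w' \in M /\ immediate_successor w w',
      forall w, w \in M -> exists! w', w' \in M /\ immediate_successor w' w
    & #|M| = (#|E| ^ d.-1)%N].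

End MockParityCheck.

(* Main.v *)
(* The lower-right entry D of pi(w) is a continuant: D (u b) = b * D u - x and
   D (a u) = a * D u + y, where x, y are the off-diagonal entries of pi(u), and
   x * y = -1 when D u = 0 because pi(u) has determinant 1.  Hence a word u with
   D u <> 0 has exactly one right extension with D (u b) = 0, while for D u = 0
   there is none.  In the latter case u = a v with D v <> 0, so exactly one b
   gives D (v b) = 0.  Either way every word of length l - 1 has exactly one
   right extension in M^l, which yields both the unique successors and the
   cardinality.  Since D is invariant under reversal of words, so is M^l, and
   unique predecessors follow. *)
Require Import Defs.
From mathcomp Require Import all_boot all_order all_algebra.

Set Implicit Arguments.
Unset Strict Implicit.

Section Continuants.
Import GRing.Theory.
Local Open Scope ring_scope.
Variable k : fieldType.
Implicit Types (u v w : seq k) (a b : k).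

Local Notation D w := (word_mx w 1 1).

Lemma det_mx22 (A : 'M[k]_2) : \det A = A 0 0 * A 1 1 - A 0 1 * A 1 0.
Proof.
rewrite (expand_det_row _ ord0) !big_ord_recl big_ord0 addr0 /cofactor.
rewrite !det_mx11 !mxE expr0 expr1 mul1r mulN1r mulrN.
by congr (A _ _ * A _ _ - A _ _ * A _ _); apply/val_inj.
Qed.

Lemma mulmx22E (A B : 'M[k]_2) i j : (A *m B) i j = A i 0 * B 0 j + A i 1 * B 1 j.
Proof.
rewrite mxE !big_ord_recl big_ord0 addr0.
by congr (_ + A _ _ * B _ _); apply/val_inj.
Qed.

Lemma word_mx_cons a w : word_mx (a :: w) = Mgen a *m word_mx w.
Proof. by rewrite /word_mx big_cons. Qed.

Lemma word_mx_rcons w a : word_mx (rcons w a) = word_mx w *m Mgen a.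
Proof. by rewrite /word_mx -cats1 big_cat big_seq1. Qed.

Lemma det_word_mx w : \det (word_mx w) = 1.
Proof.
elim: w => [|a w IHw]; first by rewrite /word_mx big_nil det1.
by rewrite word_mx_cons det_mulmx IHw det_mx22 !mxE /= mul0r sub0r !mulr1 opprK.
Qed.

Lemma word_mx_rcons11 w a : D (rcons w a) = a * D w - word_mx w 1 0.
Proof.
by rewrite word_mx_rcons mulmx22E !mxE /= mulrN1 addrC mulrC.
Qed.

Lemma word_mx_nil11 : D ([::] : seq k) = 1.
Proof. by rewrite /word_mx big_nil mxE. Qed.

Lemma word_mx10_neq0 w : D w = 0 -> word_mx w 1 0 != 0.
Proof.
move=> w0; apply/eqP => w10; have /eqP := det_word_mx w.
by rewrite det_mx22 w0 w10 !mulr0 subr0 eq_sym oner_eq0.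
Qed.

Lemma word_mx_rcons11_neq0 w a : D w = 0 -> D (rcons w a) != 0.
Proof.
by move=> w0; rewrite word_mx_rcons11 w0 mulr0 sub0r oppr_eq0 word_mx10_neq0.
Qed.

Lemma word_mx_rcons11_eq0 w a :
  D w != 0 -> (D (rcons w a) == 0) = (a == word_mx w 1 0 / D w).
Proof.
by move=> w0; rewrite word_mx_rcons11 subr_eq0 -{1}(divfK w0 (word_mx w 1 0))
  (inj_eq (mulIf w0)).
Qed.

(* Conjugation by diag(1, -1) turns each generator into its transpose. *)
Lemma word_mx_rev w i j : word_mx (rev w) i j = (-1) ^+ (i + j) * word_mx w j i.
Proof.
elim: w i j => [|a w IHw] i j.
  rewrite /word_mx big_nil !mxE eq_sym; case: eqP => [->|_]; last by rewrite mulr0.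
  by rewrite addnn -mul2n exprM sqrrN expr1n expr1n mulr1.
rewrite rev_cons word_mx_rcons word_mx_cons !mulmx22E !IHw !mxE.
by case: i j => [[|[|//]] ?] [[|[|//]] ?]; rewrite /= ?expr0 ?expr1 ?sqrrN
  ?expr1n; rewrite ?(mulr0, mul0r, mul1r, mulr1, mulrN, mulNr, opprK, addr0,
  add0r, opprD, oppr0) //
  [_ * a]mulrC.
Qed.

Lemma word_mx_rev11 w : D (rev w) = D w.
Proof. by rewrite word_mx_rev sqrrN expr1n mul1r. Qed.

Lemma wordA_rev w : (rev w \in wordA) = (w \in wordA).
Proof. by rewrite !inE word_mx_rev11. Qed.

(** Membership in M^l with l = [size w], put on plain sequences so that reversal and extension need
    no tuples. The condition that the word lie in [wordC] is absorbed by the disjunction. *)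
Definition mock_word w :=
  (w \in wordA) || (take (size w).-1 w \in wordA) && (behead w \in wordA).

Lemma mock_word_rev w : mock_word (rev w) = mock_word w.
Proof.
case: w => // a w; rewrite /mock_word size_rev -!drop1 drop_rev take_rev subn1.
by rewrite subSnn !wordA_rev [X in _ || X]andbC.
Qed.

Lemma mock_word_rcons u : exists c, forall b, mock_word (rcons u b) = (b == c).
Proof.
have mE b : mock_word (rcons u b) =
    (rcons u b \in wordA) || (u \in wordA) && (behead (rcons u b) \in wordA).
  by rewrite /mock_word size_rcons /= -{2}cats1 take_size_cat.
have [u0|u_neq0] := eqVneq (D u) 0; last first.
  exists (word_mx u 1 0 / D u) => b.
  by rewrite mE !inE (negPf u_neq0) orbF word_mx_rcons11_eq0.
case: u u0 mE => [|a v] v0 mE.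
  by move/eqP: v0; rewrite word_mx_nil11 oner_eq0.
(* [rev (a :: v)] extends [rev v] on the right by [a], so D v = 0 would contradict [v0]. *)
have v_neq0 : D v != 0.
  apply/eqP => Dv; have := word_mx_rcons11_neq0 (w := rev v) a.
  by rewrite -rev_cons !word_mx_rev11 v0 eqxx => /(_ Dv).
exists (word_mx v 1 0 / D v) => b.
rewrite mE !inE (negPf (word_mx_rcons11_neq0 b v0)) v0 eqxx /=.
exact: word_mx_rcons11_eq0.
Qed.

End Continuants.

Lemma words_ME (k : finFieldType) l (w : l.-tuple k) :
  (w \in words_M k l) = mock_word w.
Proof.
by rewrite !inE /mock_word size_tuple !inE; case: (word_mx w _ _ == _).
Qed.

Lemma immediate_successorP (E : finType) n (w w' : n.+1.-tuple E) :
  immediate_successor w w' <-> behead w = take n w'.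
Proof.
split=> [[a [-> ->]]|].
  by case: a => [[|x [|y s]] //= ]; rewrite ?take0.
case/tupleP: w => x w /= ww'.
(* The common word of length n + 2 is [w'] preceded by the first letter [x]. *)
have sz : size (x :: w') == n.+2 by rewrite /= size_tuple.
by exists (Tuple sz); rewrite /= -ww'.
Qed.

(** Existence and uniqueness in one boolean equality serve both the successors and the count. *)
Lemma mock_word_rcons_tuple (k : fieldType) n (u : n.-tuple k) :
  exists c, forall w : n.+1.-tuple k,
    mock_word w && (take n w == u) = (w == [tuple of rcons u c]).
Proof.
have [c cP] := mock_word_rcons u; exists c => w.
case: w => w szw; rewrite -val_eqE /=.
case/lastP: w szw => // w b szw; move: (szw); rewrite size_rcons eqSS => /eqP szu.
rewrite -{2}cats1 take_size_cat // eqseq_rcons andbC.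
by case: eqP => //= ->; rewrite cP.
Qed.

Unset Implicit Arguments.
Set Strict Implicit.

Theorem theorem2p15 (k : finFieldType) (l : nat) (hl : (1 <= l)%N) :
  mock_parity_check_set (words_M k l).
Proof.
case: l hl => // n _.
have ext (u : n.-tuple k) := mock_word_rcons_tuple u.
(* The successor is the extension of [behead w]; the claim covers every word, so it applies to
   [rev w] below. *)
have succP (w : n.+1.-tuple k) :
    exists! w', w' \in words_M k n.+1 /\ immediate_successor w w'.
  have [c cP] := ext [tuple of behead w].
  exists [tuple of rcons (behead w) c]; split=> [|w' [Mw' /immediate_successorP ww']].
    have /andP[Mw' /eqP ww'] : _ && _ := etrans (cP _) (eqxx _).
    by rewrite words_ME; split=> //; apply/immediate_successorP.
  by apply/esym/eqP; rewrite -cP -words_ME Mw' -ww' /=.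
split=> [|w _|w _|].
- apply/card_gt1P; exists 0%R, 1%R; split=> //.
  by rewrite eq_sym GRing.oner_neq0.
- exact: succP.
(* Reversal swaps successors and predecessors and preserves M, so the predecessor of [w] is the
   reversed successor of [rev w]. *)
- have revS (v v' : n.+1.-tuple k) : immediate_successor v v' ->
      immediate_successor [tuple of rev v'] [tuple of rev v].
    move/immediate_successorP => vv'; apply/immediate_successorP => /=.
    apply: (can_inj revK); rewrite take_rev revK size_tuple subSnn drop1 vv'.
    rewrite -drop1 drop_rev size_tuple subn1 /= revK //.
  have [w' [[Mw' ww'] w'P]] := succP [tuple of rev w].
  have revT : involutive (fun v : n.+1.-tuple k => [tuple of rev v]).
    by move=> v; apply/val_inj/revK.
  exists [tuple of rev w']; split.
    split; first by rewrite words_ME mock_word_rev -words_ME.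
    by move/revS: ww'; rewrite revT.
  move=> v [Mv /revS vw]; rewrite (w'P [tuple of rev v]) ?revT //.
  by split=> //; rewrite words_ME mock_word_rev -words_ME.
(* Choosing [c u] for each prefix [u] parametrizes M bijectively by the words of length n. *)
have [c cP] := fin_all_exists ext.
have -> : words_M k n.+1 = [set [tuple of rcons u (c u)] | u : n.-tuple k].
  apply/setP=> w; apply/idP/imsetP => [Mw|[u _ ->]].
    have sz : size (take n w) == n by rewrite size_takel ?size_tuple.
    exists (Tuple sz) => //; apply/eqP.
    by rewrite -cP -words_ME Mw /=.
  by have /andP[Mw _] := etrans (cP u _) (eqxx _); rewrite words_ME.
rewrite card_imset ?card_tuple // => u v /(congr1 val) /= /eqP.
by rewrite eqseq_rcons => /andP[/eqP /val_inj].
Qed.
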